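(* Let $n \geq 2$. The set of all ordered multiplicity lists attained by matrices in $\mathcal{S}_L(K_{1,n-1})$ is exactly the set of lists $(m_1, \ldots, m_q)$ of positive integers (of any length $q$) such that: (i) $m_1 = m_q = 1$; (ii) for all $k$ with $1\le k\le q-1$, $m_k \geq 2$ implies $m_{k+1} = 1$; and (iii) $m_1 + \cdots + m_q = n$.
   Context: Graphs are finite and simple; $K_{1,n-1}$ is the star on $n$ vertices. For a graph $G$ on $n$ vertices, $\mathcal{S}_L(G)$ denotes the set of $n\times n$ real symmetric matrices $A=[a_{i,j}]$ such that $a_{i,j}<0$ if $\{i,j\}\in E(G)$, $a_{i,j}=0$ if $i\neq j$ and $\{i,j\}\notin E(G)$, and $a_{i,i}=-\sum_{k\neq i}a_{i,k}$ for all $i$. The ordered multiplicity list of $A\in\mathcal{S}_L(G)$ is $(m_1,\ldots,m_q)$, where $\lambda_1<\lambda_2<\cdots<\lambda_q$ are the distinct eigenvalues of $A$ in increasing order and $m_i$ is the multiplicity of $\lambda_i$. *)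

(* Defs.v *)
From HB Require Import structures.
From mathcomp Require Import all_boot all_order all_algebra.
From mathcomp Require Import reals.

Set Implicit Arguments.
Unset Strict Implicit.
Unset Printing Implicit Defensive.

Import Order.TTheory GRing.Theory Num.Theory.
Local Open Scope ring_scope.

Record sgraph (n : nat) := SGraph {
  adj :> rel 'I_n;
  adj_sym : symmetric adj;
  adj_irr : irreflexive adj }.

(* The centre of the star is the vertex with value 0. *)
Definition star_adj (n : nat) : rel 'I_n :=
  fun i j => (i != j) && ((val i == 0%N) || (val j == 0%N)).

Lemma star_adj_sym (n : nat) : symmetric (@star_adj n).
Proof. by move=> i j; rewrite /star_adj eq_sym orbC. Qed.

Lemma star_adj_irr (n : nat) : irreflexive (@star_adj n).
Proof. by move=> i; rewrite /star_adj eqxx. Qed.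

Definition star (n : nat) : sgraph n :=
  SGraph (@star_adj_sym n) (@star_adj_irr n).

Definition SL (R : realType) (n : nat) (G : sgraph n) (A : 'M[R]_n) : Prop :=
  [/\ A^T = A,
      forall i j, G i j -> A i j < 0,
      forall i j, i != j -> ~~ G i j -> A i j = 0 &
      forall i, A i i = - \sum_(k | k != i) A i k].

(* Multiplicities are algebraic, i.e. as roots of the characteristic polynomial. *)
Definition ordered_mult_list (R : realType) (n : nat) (A : 'M[R]_n)
    (m : seq nat) : Prop :=
  exists lam : seq R,
    [/\ sorted <%R lam,
        forall x, (x \in lam) = eigenvalue A x &
        m = [seq mup x (char_poly A) | x <- lam]].

(* Main.v *)
Require Import Defs.
From mathcomp Require Import all_boot all_order all_algebra.
From mathcomp Require Import reals.
From mathcomp Require Import polyrcf ring zify.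

(** A matrix of S_L(K_{1,N}) is the Laplacian of a star whose edges carry
    positive weights w_1, ..., w_N: the entries off the centre are diagonal, so
    that it is an arrowhead matrix, and its characteristic polynomial is
      X * (prod_i (X - w_i) - sum_i w_i prod_(k != i) (X - w_k)).
    Let d_1 < ... < d_p be the distinct weights and c_j the number of edges of
    weight d_j.  Each d_j is a common root of order c_j - 1 of all the products,
    and what remains of the second factor is the polynomial
      Q = prod_j (X - d_j) - sum_j c_j d_j prod_(l != j) (X - d_l),
    that is, the numerator of 1 - sum_j c_j d_j / (X - d_j).  At d_j only one
    term of Q survives; its sign alternates with j and is negative at d_p.  As
    Q is monic of degree p, it has exactly one root mu_j between d_j and d_(j+1), the
    last one mu_p lying beyond d_p, and
      0 < d_1 < mu_1 < d_2 < mu_2 < ... < d_p < mu_p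
    where 0 and the mu_j are simple eigenvalues and d_j has multiplicity
    c_j - 1, being no eigenvalue when c_j = 1.

    The multiplicity list is therefore 1, c_1 - 1, 1, c_2 - 1, 1, ..., c_p - 1, 1
    with the zeros deleted ([ordered_mult_list_star]).  The c_j are arbitrary
    positive integers of sum N, because any multiset of positive reals may serve
    as weights ([weights_exist]).  It remains to see that the lists of this
    shape are those which begin and end with 1 and have no two consecutive
    entries at least 2 ([interlace_onesP]): reading such a list from the left
    after its first entry, an entry k >= 2 is followed by a 1 and gives the block
    k, 1, and an entry 1 gives the block 0, 1. *)

Set Implicit Arguments.
Unset Strict Implicit.
Unset Printing Implicit Defensive.

Import Order.TTheory GRing.Theory Num.Theory.
Local Open Scope ring_scope.

(** * Lists of blocks k, 1 *)

Definition interlace_ones (e : seq nat) : seq nat :=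
  flatten [seq [:: k; 1%N] | k <- e].

Lemma sorted_interlace_ones (e : seq nat) :
  sorted (fun a b => (2 <= a)%N ==> (b == 1)%N)
    (1%N :: [seq k <- interlace_ones e | (0 < k)%N]).
Proof. by elim: e => [|[|[|k]] e IHe] //=. Qed.

Lemma last_interlace_ones (e : seq nat) :
  last 1%N [seq k <- interlace_ones e | (0 < k)%N] = 1%N.
Proof. by elim: e => [|[|k] e IHe] //=. Qed.

Lemma sumn_interlace_ones (e : seq nat) :
  sumn [seq k <- interlace_ones e | (0 < k)%N] = sumn [seq k.+1 | k <- e].
Proof. by elim: e => [|[|k] e IHe] //=; rewrite IHe; lia. Qed.

(** Reading from the left decides the blocks: an entry at least 2 takes the
    following 1 with it, while an entry 1 is the rest of a block whose 0 was
    deleted.  The default value 1 of [last] admits the empty list. *)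
Lemma interlace_ones_exists (r : seq nat) :
    all (ltn 0) r -> last 1%N r = 1%N ->
    sorted (fun a b => (2 <= a)%N ==> (b == 1)%N) r ->
  exists e, r = [seq k <- interlace_ones e | (0 < k)%N].
Proof.
have [n] := ubnP (size r); elim: n r => // n IHn [|[|[|k]] r] //= rn.
- by exists [::].
- move=> r0 r1 rs; have [|e ->] := IHn r rn r0 r1; first exact: path_sorted rs.
  by exists (0%N :: e).
case: r rn => [|a r] //= rn /andP[_ r0] r1 /andP[/eqP a1 rs]; subst a.
have [|e ->] := IHn r _ r0 r1 (path_sorted rs); first by rewrite -ltnS ltnW.
by exists (k.+2 :: e).
Qed.

Lemma interlace_onesP (n : nat) (m : seq nat) : (1 < n)%N ->
  [/\ forall k : nat, (k < size m)%N -> (0 < nth 0%N m k)%N,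
      head 0%N m = 1%N /\ last 0%N m = 1%N,
      forall k : nat, (k.+1 < size m)%N -> (2 <= nth 0%N m k)%N ->
        nth 0%N m k.+1 = 1%N &
      (\sum_(i <- m) i)%N = n] <->
  exists2 e, (sumn [seq k.+1 | k <- e]).+1 = n &
    m = [seq k <- 1%N :: interlace_ones e | (0 < k)%N].
Proof.
move=> n1; split=> [[m0 [mh ml] m2 mn]|[e en ->]].
  case: m => [|a r] //= in m0 mh ml m2 mn *; subst a.
  have [|||e re] := @interlace_ones_exists r.
  - by apply/(all_nthP 0%N) => k kr; exact: (m0 k.+1).
  - by [].
  - apply/(sortedP 0%N) => k kr; apply/implyP => k2.
    by apply/eqP; exact: (m2 k.+1).
  exists e; last by rewrite re.
  by rewrite -mn -sumnE /= re sumn_interlace_ones.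
split.
- by move=> k /(mem_nth 0%N); rewrite mem_filter => /andP[].
- by rewrite /= last_interlace_ones.
- move=> k /= kr k2; apply/eqP; move: k2; apply/implyP.
  by have /(sortedP 0%N) /(_ k kr) := sorted_interlace_ones e.
- by rewrite -sumnE /= sumn_interlace_ones.
Qed.

(** * Multiplicity lists from a factorization *)

Lemma root_prod_weighted (F : fieldType) (z : seq (F * nat)) (x : F) :
  root (\prod_(p <- z) ('X - p.1%:P) ^+ p.2) x =
    (x \in [seq p.1 | p <- z & (0 < p.2)%N]).
Proof.
elim: z => [|[y k] z IHz] /=; first by rewrite big_nil (negPf (root1 x)).
rewrite big_cons rootM IHz /=; case: k => [|k] /=.
  by rewrite expr0 (negPf (root1 x)).
by rewrite rootE !(hornerE, horner_exp) expf_eq0 /= subr_eq0 inE.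
Qed.

Lemma mup_prod_weighted (F : fieldType) (z : seq (F * nat)) p :
    uniq (unzip1 z) -> p \in z ->
  mup p.1 (\prod_(q <- z) ('X - q.1%:P) ^+ q.2) = p.2.
Proof.
elim: z => [|q z IHz] //= /andP[qz uz]; rewrite inE big_cons.
case: eqVneq => [->|_] /= pz.
  rewrite mupMl ?mup_XsubCX ?eqxx // root_prod_weighted.
  by apply: contra qz => /mapP[r]; rewrite mem_filter => /andP[_ rz] ->; apply: map_f.
rewrite mupMr ?IHz //; rewrite rootE horner_exp !hornerE expf_eq0 subr_eq0.
rewrite negb_and; apply/orP; right; apply: contraNneq qz => <-; exact: map_f.
Qed.

(** Allowing exponents 0 gives one factorization for all stars, since a weight
    of a single edge enters with exponent 0.  Deleting these points leaves the
    increasing list of the eigenvalues, which is unique. *)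
Lemma ordered_mult_list_factored (R : realType) n (A : 'M[R]_n)
    (z : seq (R * nat)) (m : seq nat) :
    char_poly A = \prod_(p <- z) ('X - p.1%:P) ^+ p.2 ->
    sorted <%R (unzip1 z) ->
  ordered_mult_list A m <-> m = [seq k <- unzip2 z | (0 < k)%N].
Proof.
move=> Az zs; pose z' := [seq p <- z | (0 < p.2)%N].
have z's : sorted <%R (unzip1 z').
  apply: subseq_sorted zs; first exact: lt_trans.
  by apply: map_subseq; exact: filter_subseq.
have mem_z' x : (x \in unzip1 z') = eigenvalue A x.
  by rewrite eigenvalue_root_char Az root_prod_weighted.
have mz' : [seq mup x (char_poly A) | x <- unzip1 z'] =
    [seq k <- unzip2 z | (0 < k)%N].
  rewrite filter_map -map_comp; apply/eq_in_map => p.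
  rewrite mem_filter => /andP[_ pz] /=.
  by rewrite Az mup_prod_weighted // (lt_sorted_uniq zs).
split=> [[lam [ls lamA ->]]|->]; last by exists (unzip1 z').
rewrite -mz'; congr map; apply: lt_sorted_eq => // x.
by rewrite lamA mem_z'.
Qed.

(** * The secular polynomial *)

(** The intermediate value theorem gives a root between consecutive points with
    opposite signs, and a last one beyond the final point because a polynomial
    with positive leading coefficient ends up positive.  Each point is paired
    with the root that follows it. *)
Lemma interlacing_roots_exist (R : rcfType) (q : {poly R}) (x : R) (d : seq R) :
    path (fun a b => (a < b) && (q.[a] * q.[b] < 0)) x d ->
    q.[last x d] < 0 -> 0 < lead_coef q ->
  exists z : seq (R * R),
    [/\ unzip1 z = x :: d, sorted <%R (flatten [seq [:: p.1; p.2] | p <- z]) &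
        all (root q) (unzip2 z)].
Proof.
move=> + + q0; elim: d x => [|y d IHd] x /=.
  move=> _ qx; have [b0 qb0] := poly_pinfty_gt_lc q0.
  pose b := Num.max b0 (x + 1).
  have qb : 0 < q.[b] by apply: lt_le_trans q0 (qb0 _ _); rewrite le_max lexx.
  have xb : x <= b by rewrite le_max lerDl ler01 orbT.
  have [|r] := @poly_ivtoo _ q x b xb; first by rewrite pmulr_llt0.
  rewrite in_itv /= => /andP[xr _] qr.
  by exists [:: (x, r)]; rewrite /= xr qr.
case/andP=> /andP[xy qxy] yd ql.
have [[|[y1 r1] z] [//= [y1y dz] zs zr]] := IHd y yd ql; subst y1.
have [r] := @poly_ivtoo _ q x y (ltW xy) qxy.
rewrite in_itv /= => /andP[xr ry] qr.
by exists [:: (x, r), (y, r1) & z]; split; rewrite /= ?dz // ?xr ?ry ?qr.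
Qed.

(** The numerator of 1 - sum_x c(x) x / (X - x) over the product of the X - x;
    its roots are the eigenvalues of the star that are neither 0 nor weights. *)
Definition secular (R : comNzRingType) (c : R -> nat) (d : seq R) : {poly R} :=
  \prod_(x <- d) ('X - x%:P) -
  \sum_(x <- d) (x *+ c x)%:P * \prod_(y <- d | y != x) ('X - y%:P).

Section Secular.
Variables (R : rcfType) (c : R -> nat) (d : seq R).
Hypothesis d_uniq : uniq d.

(** Every other term contains the factor X - x. *)
Lemma horner_secular x : x \in d ->
  (secular c d).[x] = - (x *+ c x) * \prod_(y <- d | y != x) (x - y).
Proof.
move=> xd; rewrite /secular hornerD hornerN horner_sum [\prod_(x <- d) _](bigD1_seq x) //=.
rewrite hornerM hornerXsubC subrr mul0r sub0r (bigD1_seq x) //= [X in _ + X]big1_seq ?addr0 => [|y /andP[yx yd]].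
  rewrite hornerM hornerC horner_prod mulNr; congr (- (_ * _)).
  by apply: eq_bigr => y _; rewrite hornerXsubC.
apply/eqP; rewrite hornerM horner_prod mulf_eq0 prodf_seq_eq0; apply/orP; right.
by apply/hasP; exists x => //; rewrite eq_sym yx hornerXsubC subrr /=.
Qed.

Lemma size_secular_tail :
  (size (\sum_(x <- d) (x *+ c x)%:P * \prod_(y <- d | y != x) ('X - y%:P))%R
    < (size d).+1)%N.
Proof.
rewrite ltnS; apply: leq_trans (size_sum _ _ _) _; apply/bigmax_leqP_seq => x xd _.
rewrite mul_polyC (leq_trans (size_scale_leq _ _)) // -big_filter size_prod_XsubC.
rewrite size_filter -(count_predC (pred1 x) d) -addn1 addnC leq_add2r.
by rewrite -has_count has_pred1.
Qed.

Lemma size_secular : size (secular c d) = (size d).+1.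
Proof.
by rewrite size_polyDl size_prod_XsubC // size_polyN size_secular_tail.
Qed.

Lemma secular_monic : secular c d \is monic.
Proof.
rewrite monicE lead_coefDl ?lead_coef_prod_XsubC //.
by rewrite size_polyN size_prod_XsubC size_secular_tail.
Qed.

(** Grouping equal weights: with G the product of the (X - x)^(c(x) - 1), the
    product over all the edges is G times that over the distinct weights, and
    cancelling one factor X - w_i gives the same for the product over the edges
    other than i. *)
Lemma secular_factor (I : finType) (w : I -> R) :
    d =i codom w -> (forall x, c x = count_mem x (codom w)) ->
  \prod_i ('X - (w i)%:P) - \sum_i (w i)%:P * \prod_(k | k != i) ('X - (w k)%:P) =
  \prod_(x <- d) ('X - x%:P) ^+ (c x).-1 * secular c d.
Proof.
move=> dw cw; set G := \prod_(x <- d) _.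
have dperm : perm_eq d (undup (codom w)).
  by apply: uniq_perm (undup_uniq _) _ => // x; rewrite mem_undup dw.
have bigw (F : R -> {poly R}) : \sum_i F (w i) = \sum_(x <- d) F x *+ c x.
  have -> : \sum_i F (w i) = \sum_(x <- codom w) F x by rewrite big_image.
  rewrite (perm_big _ dperm) -big_undup_iterop_count /=.
  by apply: eq_bigr => x _; rewrite cw.
have prodw : \prod_i ('X - (w i)%:P) = G * \prod_(x <- d) ('X - x%:P).
  transitivity (\prod_(x <- codom w) ('X - x%:P)); first by rewrite big_image.
  rewrite -prodr_undup_exp_count -(perm_big _ dperm) -big_split /=.
  rewrite big_seq [RHS]big_seq; apply: eq_bigr => x xd.
  by rewrite -exprSr cw prednK // -has_count has_pred1 -dw.
rewrite mulrBr prodw; congr (_ - _).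
under eq_bigr => i _.
  have -> : \prod_(k | k != i) ('X - (w k)%:P) =
      G * \prod_(y <- d | y != w i) ('X - y%:P).
    apply: (mulfI (negbT (polyXsubC_eq0 (w i)))).
    have <- : \prod_k ('X - (w k)%:P) =
        ('X - (w i)%:P) * \prod_(k | k != i) ('X - (w k)%:P) by rewrite (bigD1 i).
    by rewrite prodw mulrCA (bigD1_seq (w i)) ?dw ?codom_f.
  over.
rewrite (bigw (fun x => x%:P * (G * \prod_(y <- d | y != x) ('X - y%:P)))).
rewrite mulr_sumr; apply: eq_bigr => x _.
by rewrite polyCMn mulrnAl mulrnAr mulrCA.
Qed.

End Secular.

(** For consecutive a < b in d, the values at a and b differ in sign: the factors
    contributed by any third point of d have the same sign at a and at b, since
    that point does not lie between them, and a - b and b - a do not.  At the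
    largest point all the factors are positive, so the value is negative.  This
    provides as many roots as the degree. *)
Lemma secular_roots (R : rcfType) (c : R -> nat) (d : seq R) :
    sorted <%R d -> {in d, forall x, (0 < x) && (0 < c x)%N} ->
  exists z : seq (R * R),
    [/\ unzip1 z = d, sorted <%R (flatten [seq [:: p.1; p.2] | p <- z]) &
        secular c d = \prod_(p <- z) ('X - p.2%:P)].
Proof.
move=> ds d0; have du := lt_sorted_uniq ds; set q := secular c d.
have wt x : x \in d -> 0 < x *+ c x.
  by move=> /d0 /andP[x0 cx]; rewrite pmulrn_lgt0.
have prodD1 a b (F : R -> R) : b \in d -> b != a ->
    \prod_(y <- d | y != a) F y = F b * \prod_(y <- d | (y != a) && (y != b)) F y.
  move=> bd ba; rewrite -big_filter (bigD1_seq b) ?mem_filter ?filter_uniq ?ba //=.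
  by rewrite big_filter_cond.
have qmon : q \is monic by exact: secular_monic.
case dE : d => [|x0 d'].
  by exists [::]; split=> //=; rewrite /q dE /secular !big_nil subr0.
have [|||z [zd zs zr]] := @interlacing_roots_exist R q x0 d'.
- have : sorted (fun a b => (a < b) && (q.[a] * q.[b] < 0)) d; last by rewrite dE.
  apply/(sortedP x0) => i id.
  have i'd : (i < size d)%N by exact: ltnW.
  have nthd j : (j < size d)%N -> nth x0 d j \in d by exact: mem_nth.
  have ab : nth x0 d i < nth x0 d i.+1 by exact/(sortedP x0).
  rewrite ab /= !horner_secular ?nthd //.
  set a := nth x0 d i in ab *; set b := nth x0 d i.+1 in ab *.
  have ad : a \in d by exact: nthd.
  have bd : b \in d by exact: nthd.
  rewrite (prodD1 a b) ?(gt_eqF ab) // (prodD1 b a) ?(lt_eqF ab) //.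
  rewrite [X in _ * (_ * (_ * X))](eq_bigl (fun y => (y != a) && (y != b))); last first.
    by move=> y; rewrite andbC.
  set P := \prod_(_ <- _ | _) _; set Q := \prod_(_ <- _ | _) _.
  have PQ : 0 < P * Q.
    rewrite /P /Q -big_split /= big_seq_cond; apply: prodr_gt0 => y.
    case/and3P => yd ya yb.
    have := index_mem y d; rewrite yd => yi.
    have ynth : y = nth x0 d (index y d) by rewrite nth_index.
    have [yi1|] := ltnP (index y d) i.
      have ya' : y < a by rewrite ynth /a (lt_sorted_ltn_nth x0 ds).
      by rewrite mulr_gt0 // subr_gt0 // (lt_trans ya').
    rewrite leq_eqVlt => /orP[/eqP iy|]; first by rewrite ynth -iy eqxx in ya.
    rewrite leq_eqVlt => /orP[/eqP iy|iy]; first by rewrite ynth -iy eqxx in yb.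
    have yb' : b < y by rewrite ynth /b (lt_sorted_ltn_nth x0 ds).
    by rewrite nmulr_rgt0 subr_lt0 // (lt_trans ab).
  have -> : - (a *+ c a) * ((a - b) * P) * (- (b *+ c b) * ((b - a) * Q)) =
     - ((a *+ c a) * (b *+ c b) * ((b - a) ^+ 2 * (P * Q))) by ring.
  by rewrite oppr_lt0 !(pmulr_lgt0 _ PQ, pmulr_rgt0) ?wt ?subr_gt0.
- have ld : last x0 d' \in d by rewrite dE mem_last.
  rewrite horner_secular // mulNr oppr_lt0 mulr_gt0 ?wt //.
  rewrite big_seq_cond; apply: prodr_gt0 => y /andP[yd yl].
  have lE : last x0 d' = nth x0 d (size d').
    by rewrite dE -[size d']/(size (x0 :: d')).-1 nth_last.
  rewrite subr_gt0 lt_neqAle yl lE -{1}(nth_index x0 yd) /=.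
  rewrite (lt_sorted_leq_nth x0 ds) ?inE ?index_mem //; last by rewrite dE /=.
  by rewrite -ltnS; move: yd; rewrite -index_mem dE.
- by rewrite (monicP qmon).
exists z; split=> //.
rewrite [LHS](@all_roots_prod_XsubC _ _ (unzip2 z)) //.
- by rewrite (monicP qmon) scale1r big_map.
- by rewrite size_secular // dE -zd !size_map.
rewrite uniq_rootsE.
have : uniq (flatten [seq [:: p.1; p.2] | p <- z]) by exact: lt_sorted_uniq zs.
apply: subseq_uniq; elim: (z) => [|p z' IHz] //=.
exact: (@cat_subseq _ [:: p.2] _ [:: p.1; p.2] _ (suffix_subseq [:: p.1] _) IHz).
Qed.

(** * Laplacians of weighted stars *)

(** Schur complement without division: multiplying on the right by the block
    matrix (de, 0; -v, 1), where de is the determinant of the diagonal block and v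
    is its adjugate applied to c, makes the product block upper triangular.  The extra factor de is then
    cancelled, which is why the entries of d must be nonzero. *)
Lemma det_arrow (K : idomainType) (N : nat) (al : K) (b : 'rV[K]_N)
    (c : 'cV[K]_N) (d : 'rV[K]_N) : (forall i, d 0 i != 0) ->
  \det (block_mx al%:M b c (diag_mx d)) =
    al * \prod_i d 0 i - \sum_i b 0 i * c i 0 * \prod_(k | k != i) d 0 k.
Proof.
move=> d0; set de := \prod_i d 0 i.
have de0 : de != 0 by rewrite prodf_seq_neq0; apply/allP => i _; exact: d0.
pose v : 'cV[K]_N := \col_i (c i 0 * \prod_(k | k != i) d 0 k).
apply: (mulIf de0).
have -> : de = \det (block_mx de%:M 0 (- v) (1%:M : 'M_N)).
  by rewrite det_lblock det1 mulr1 det_scalar1.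
rewrite -det_mulmx mulmx_block !mulmx0 !mulmx1 !add0r.
have -> : c *m de%:M + diag_mx d *m - v = 0.
  rewrite mulmxN mul_mx_scalar mul_diag_mx; apply/matrixP => i j.
  by rewrite !mxE ord1 /de (bigD1 i) //=; ring.
rewrite det_ublock det_diag -/de det_lblock det1 mulr1 det_scalar1.
rewrite det_mx11 !mxE; congr (_ * _).
rewrite big_ord1 !mxE /= mulr1n; congr (_ + _).
rewrite -sumrN; apply: eq_bigr => i _.
by rewrite !mxE mulrN mulrA.
Qed.

Definition star_laplacian (R : comNzRingType) (N : nat) (w : 'I_N -> R) :
    'M[R]_(1 + N) :=
  block_mx (\sum_i w i)%:M (- \row_i w i) (- \col_i w i) (diag_mx (\row_i w i)).

Lemma char_poly_star_laplacian (R : idomainType) (N : nat) (w : 'I_N -> R) :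
  char_poly (star_laplacian w) =
  'X * (\prod_i ('X - (w i)%:P) -
        \sum_i (w i)%:P * \prod_(k | k != i) ('X - (w k)%:P)).
Proof.
rewrite /char_poly.
have -> : char_poly_mx (star_laplacian w) =
  block_mx ('X - (\sum_i w i)%:P)%:M (\row_i (w i)%:P) (\col_i (w i)%:P)
    (diag_mx (\row_i ('X - (w i)%:P))).
  rewrite /char_poly_mx map_block_mx (@scalar_mx_block _ 1 N) opp_block_mx add_block_mx.
  congr block_mx; apply/matrixP => i j; rewrite !mxE ?ord1 ?sub0r ?polyCN ?opprK //.
  by case: eqP => //= _; rewrite ?mulr1n ?mulr0n ?subr0.
rewrite det_arrow => [|i]; last by rewrite mxE polyXsubC_eq0.
under eq_bigr do rewrite mxE.
set D := \prod_i _.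
(* Writing D as (X - w_i) times the remaining product absorbs the terms w_i^2. *)
have Di i : D = ('X - (w i)%:P) * \prod_(k | k != i) ('X - (w k)%:P).
  by rewrite /D (bigD1 i).
rewrite mulrBl mulrBr -addrA; congr (_ + _); rewrite raddf_sum mulr_suml mulr_sumr.
rewrite -opprD; congr (- _); rewrite -big_split /=; apply: eq_bigr => i _.
rewrite !mxE (Di i).
have -> : \prod_(k < N | k != i) (\row_j ('X - (w j)%:P)) 0 k =
    \prod_(k | k != i) ('X - (w k)%:P) by apply: eq_bigr => k _; rewrite mxE.
ring.
Qed.

Lemma star_laplacianE (R : comNzRingType) (N : nat) (w : 'I_N -> R) :
  [/\ star_laplacian w ord0 ord0 = \sum_i w i,
      forall i, star_laplacian w ord0 (lift ord0 i) = - w i,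
      forall i, star_laplacian w (lift ord0 i) ord0 = - w i &
      forall i j, star_laplacian w (lift ord0 i) (lift ord0 j) = w i *+ (i == j)].
Proof.
have o0 : ord0 = lshift N ord0 :> 'I_(1 + N) by exact: val_inj.
split=> [|i|i|i j]; rewrite -?rshift1 ?o0.
- by rewrite block_mxEul !mxE.
- by rewrite block_mxEur !mxE.
- by rewrite block_mxEdl !mxE.
- by rewrite block_mxEdr !mxE.
Qed.

(** The row of a leaf has no nonzero entries besides the diagonal one and that
    of the centre, so its zero sum determines the diagonal entry. *)
Lemma SL_starP (R : realType) (N : nat) (A : 'M[R]_N.+1) :
  SL (star N.+1) A <->
  exists2 w : 'I_N -> R, (forall i, 0 < w i) & A = star_laplacian w.
Proof.
split=> [[As Aneg A0 Ad]|[w w0 ->]].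
  have Arow i : i != ord0 -> A i i = - A ord0 i.
    move=> i0; rewrite Ad (bigD1 ord0) 1?eq_sym //= big1 ?addr0.
      by rewrite -[in LHS]As mxE.
    move=> k /andP[ki k0]; rewrite A0 1?eq_sym // /star /= /star_adj.
    by rewrite !negb_and !negb_or -!val_eqE /= in i0 k0 *; rewrite i0 k0 orbT.
  exists (fun i : 'I_N => - A ord0 (lift ord0 i)).
    by move=> i; rewrite oppr_gt0 Aneg.
  have [L00 L0i Li0 Lij] :=
    star_laplacianE (fun i : 'I_N => - A ord0 (lift ord0 i)).
  apply/matrixP => i j.
  case: (unliftP ord0 i) => [i'|] ->; case: (unliftP ord0 j) => [j'|] ->.
  - rewrite Lij; have [<-|ij] := eqVneq i' j'; first by rewrite Arow.
    by rewrite A0 ?mulr0n // /star /= /star_adj /= andbF.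
  - by rewrite [RHS](Li0 i') opprK -[in LHS]As mxE.
  - by rewrite [RHS](L0i j') opprK.
  - by rewrite [RHS]L00 Ad sumrN big_mkcond big_ord_recl /= add0r.
have [L00 L0i Li0 Lij] := star_laplacianE w; split.
- apply/matrixP => i j; rewrite mxE.
  case: (unliftP ord0 i) => [i'|] ->; case: (unliftP ord0 j) => [j'|] ->.
  + by rewrite !Lij eq_sym; case: eqVneq => // ->.
  + by rewrite L0i Li0.
  + by rewrite L0i Li0.
  + by [].
- move=> i j.
  case: (unliftP ord0 i) => [i'|] ->; case: (unliftP ord0 j) => [j'|] -> //.
  + by rewrite /star /= /star_adj /= andbF.
  + by rewrite Li0 oppr_lt0.
  + by rewrite L0i oppr_lt0.
- move=> i j.
  case: (unliftP ord0 i) => [i'|] ->; case: (unliftP ord0 j) => [j'|] -> //.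
  by rewrite Lij (inj_eq lift_inj) => /negPf ->; rewrite mulr0n.
- move=> i; case: (unliftP ord0 i) => [i'|] ->.
    rewrite (bigD1 ord0) //= big1 ?addr0 => [|k].
      by rewrite Lij Li0 eqxx opprK.
    case: (unliftP ord0 k) => [k'|] ->; last by rewrite andbF.
    by rewrite (inj_eq lift_inj) Lij eq_sym => /andP[/negPf ->].
  rewrite L00 -sumrN [RHS]big_mkcond [RHS]big_ord_recl /= add0r.
  by apply: eq_bigr => k _; rewrite L0i opprK.
Qed.

(** * The multiplicity lists of stars *)

(** The points 0, d_1, mu_1, d_2, mu_2, ... increase and carry the exponents
    1, c_1 - 1, 1, c_2 - 1, 1, ... in the characteristic polynomial. *)
Lemma ordered_mult_list_star (R : realType) (N : nat) (w : 'I_N -> R)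
    (d : seq R) (m : seq nat) :
    (forall i, 0 < w i) -> sorted <%R d -> d =i codom w ->
  ordered_mult_list (star_laplacian w) m <->
  m = [seq k <- 1%N :: interlace_ones [seq (count_mem x (codom w)).-1 | x <- d]
      | (0 < k)%N].
Proof.
move=> w0 ds dw; set c := fun x => count_mem x (codom w).
have d0 : {in d, forall x, (0 < x) && (0 < c x)%N}.
  move=> x; rewrite dw => xw; rewrite -has_count has_pred1 xw andbT.
  by have /codomP[i ->] := xw.
have [z [zd zs zq]] := secular_roots ds d0.
pose z' := (0, 1%N) :: flatten [seq [:: (p.1, (c p.1).-1); (p.2, 1%N)] | p <- z].
have -> : [seq k <- 1%N :: interlace_ones [seq (c x).-1 | x <- d] | (0 < k)%N] =
    [seq k <- unzip2 z' | (0 < k)%N].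
  congr filter; rewrite /= /interlace_ones -zd; congr (_ :: _).
  by elim: (z) => //= p t ->.
apply: ordered_mult_list_factored.
  rewrite char_poly_star_laplacian (secular_factor (c := c) (lt_sorted_uniq ds) dw) //.
  rewrite zq -zd big_map /z' big_cons /= subr0 expr1 -big_split /=; congr (_ * _).
  elim: (z) => [|p t IHt]; first by rewrite !big_nil.
  by rewrite /= !big_cons IHt /= expr1 mulrA.
have -> : unzip1 z' = 0 :: flatten [seq [:: p.1; p.2] | p <- z].
  by congr (_ :: _); elim: (z) => //= p t ->.
case: z zd zs {zq z'} => //= p t zd ->; rewrite andbT.
have pd : p.1 \in d by rewrite -zd mem_head.
by case/andP: (d0 _ pd).
Qed.

(** The weights b + 1, b + 2, ... repeated as prescribed will do; the lower
    bound b is what makes the induction on e go through. *)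
Lemma weights_exist (R : realDomainType) (e : seq nat) (b : R) :
  exists d s : seq R,
    [/\ path <%R b d, d =i s, size s = sumn [seq k.+1 | k <- e] &
        [seq (count_mem x s).-1 | x <- d] = e].
Proof.
elim: e b => [|k e IHe] b; first by exists [::], [::].
have [d [s [ds dse ss se]]] := IHe (b + 1).
have bd : {in d, forall x, b + 1 < x}.
  by move=> x xd; apply: (allP (order_path_min lt_trans ds)).
exists (b + 1 :: d), (nseq k.+1 (b + 1) ++ s); split.
- by rewrite /= ltrDl ltr01.
- by move=> x; rewrite mem_cat mem_nseq inE dse.
- by rewrite size_cat size_nseq ss.
- rewrite /= eqxx; congr (_ :: _).
    rewrite count_cat count_nseq /= eqxx mul1n.
    rewrite (_ : count _ s = 0%N) ?addn0 //; apply/count_memPn.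
    by rewrite -dse; apply/negP => /bd; rewrite ltxx.
  rewrite -[RHS]se; apply/eq_in_map => x /bd bx.
  by rewrite count_cat count_nseq /= (lt_eqF bx) mul0n.
Qed.

Lemma sumn_count_sorted (T : eqType) (s d : seq T) :
    uniq d -> d =i s ->
  sumn [seq k.+1 | k <- [seq (count_mem x s).-1 | x <- d]] = size s.
Proof.
move=> du ds; rewrite -(perm_size (perm_count_undup s)) size_flatten /shape.
rewrite -!map_comp !sumnE !big_map.
have dperm : perm_eq d (undup s).
  by apply: uniq_perm (undup_uniq _) _ => // x; rewrite mem_undup ds.
rewrite -(perm_big _ dperm) big_seq [RHS]big_seq; apply: eq_bigr => x xd /=.
by rewrite size_nseq prednK // -has_count has_pred1 -ds.
Qed.

Local Close Scope ring_scope.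

Theorem theorem3p4 (R : realType) (n : nat) (hn : (2 <= n)%N) (m : seq nat) :
  (exists A : 'M[R]_n, SL (star n) A /\ ordered_mult_list A m) <->
  [/\ forall k : nat, (k < size m)%N -> (0 < nth 0 m k)%N,
      head 0 m = 1 /\ last 0 m = 1,
      forall k : nat, (k.+1 < size m)%N -> (2 <= nth 0 m k)%N ->
        nth 0 m k.+1 = 1 &
      (\sum_(i <- m) i)%N = n].
Proof.
rewrite interlace_onesP //; case: n hn => // N _; split=> [[A [/SL_starP[w w0 ->]]]|].
  pose d := sort <=%O (undup (codom w)).
  have dw : d =i codom w by move=> x; rewrite mem_sort mem_undup.
  have ds : sorted <%R d by rewrite sort_lt_sorted undup_uniq.
  move/(ordered_mult_list_star _ w0 ds dw) => ->; eexists; last by [].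
  by rewrite sumn_count_sorted ?(lt_sorted_uniq ds) // size_codom card_ord.
case=> e [<-] ->; have [d [s [ds dse <- se]]] := weights_exist e (0%R : R).
pose w := tnth (in_tuple s).
have ws : codom w = s by rewrite codomE map_tnth_enum.
have w0 i : (0 < w i)%R.
  by apply: (allP (order_path_min lt_trans ds)); rewrite dse mem_tnth.
exists (star_laplacian w); split; first by apply/SL_starP; exists w.
apply/(ordered_mult_list_star (d := d)) => //; rewrite ?ws ?se //.
exact: path_sorted ds.
Qed.
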